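(* Let $(X,r)$ be a solution of the YBE (of arbitrary cardinality). The following properties are equivalent: (1) The solution $(X,r)$ is of finite multipermutation level. (2) The associated solution $(M,r_M)$ on the structure monoid $M=M(X,r)$ is of finite multipermutation level. (3) The associated solution $(G,r_G)$ on the structure group $G=G(X,r)$ is of finite multipermutation level.
   Context: A solution of the YBE is a pair $(X,r)$ with $X$ a non-empty set and $r\colon X^2\to X^2$, $r(x,y)=(\lambda_x(y),\rho_y(x))$, a bijective map such that all $\lambda_x,\rho_y$ are bijective and $(r\times\mathrm{id})(\mathrm{id}\times r)(r\times\mathrm{id})=(\mathrm{id}\times r)(r\times\mathrm{id})(\mathrm{id}\times r)$ on $X^3$. Retract and multipermutation level: define $x\sim y$ iff $\lambda_x=\lambda_y$ and $\rho_x=\rho_y$. Then $r$ induces a solution $\overline r(\overline x,\overline y)=(\overline{\lambda_x(y)},\overline{\rho_y(x)})$ of the YBE on $\overline X=X/{\sim}$, denoted $\mathrm{Ret}(X,r)$. Put $\mathrm{Ret}^0(X,r)=(X,r)$ and $\mathrm{Ret}^n(X,r)=\mathrm{Ret}(\mathrm{Ret}^{n-1}(X,r))$. $(X,r)$ is a multipermutation solution of (finite) level $m$ if $m\geq 0$ is the smallest integer such that $\mathrm{Ret}^m(X,r)$ has exactly one element. $M(X,r)$ is the monoid generated by $X$ with relations $x\circ y=\lambda_x(y)\circ\rho_y(x)$ ($x,y\in X$). The maps $\lambda,\rho$ extend to a homomorphism $\lambda\colon M\to\mathrm{Map}(M,M)$ and an anti-homomorphism $\rho\colon M\to\mathrm{Map}(M,M)$,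 determined by $\lambda_x(1)=1$, $\lambda_x(y_1\circ\dotsb\circ y_l)=\lambda_x(y_1)\circ\lambda_{\rho_{y_1}(x)}(y_2\circ\dotsb\circ y_l)$, $\rho_x(1)=1$, $\rho_x(y_1\circ\dotsb\circ y_l)=\rho_{\lambda_{y_l}(x)}(y_1\circ\dotsb\circ y_{l-1})\circ\rho_x(y_l)$ for $x,y_i\in X$, and $r_M(m_1,m_2)=(\lambda_{m_1}(m_2),\rho_{m_2}(m_1))$ is a solution of the YBE on $M$ extending $r$. $G=G(X,r)$ is the group with the same generators and relations as $M(X,r)$. The maps $\lambda_x,\rho_x$ induce in the same way a left action $\lambda^e\colon G\to\mathrm{Sym}(G)$ and a right action $\rho^e\colon G\to\mathrm{Sym}(G)$, and $r_G(g_1,g_2)=(\lambda^e_{g_1}(g_2),\rho^e_{g_2}(g_1))$ is a solution of the YBE on $G$. Equivalently: let $A_{\mathrm{gr}}(X,r)$ be the group, written additively, generated by $X$ with relations $x+\lambda_x(y)=\lambda_x(y)+\lambda_{\lambda_x(y)}(\rho_y(x))$; $G$ acts on it by automorphisms with $x\in X$ acting on generators as $\lambda_x$, and there is a bijective $1$-cocycle $\pi\colon G\to A_{\mathrm{gr}}(X,r)$ for this action that is the identity on generators; transporting the addition via $\pi$ makes $(G,+,\circ)$ a skew left brace, and $\lambda^e_a(b)=-a+a\circ b$, $\rho^e_b(a)=(\lambda^e_a(b))^{-1}\circ a\circ b$. *)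

(* Defs.v *)
From HB Require Import structures.
From mathcomp Require Import all_boot generic_quotient boolp.
From Corelib Require Import RelationClasses.

Set Implicit Arguments.
Unset Strict Implicit.
Unset Printing Implicit Defensive.

Local Open Scope quotient_scope.

Definition lam_of (X : Type) (r : X * X -> X * X) (x y : X) : X := (r (x, y)).1.

(* [rho_of r y x] is rho_y(x): the subscript comes first. *)
Definition rho_of (X : Type) (r : X * X -> X * X) (y x : X) : X := (r (x, y)).2.

Definition on12 (X : Type) (r : X * X -> X * X) (t : X * X * X) : X * X * X :=
  let: (x, y, z) := t in let: (a, b) := r (x, y) in (a, b, z).

Definition on23 (X : Type) (r : X * X -> X * X) (t : X * X * X) : X * X * X :=
  let: (x, y, z) := t in let: (b, c) := r (y, z) in (x, b, c).

Definition yang_baxter (X : Type) (r : X * X -> X * X) : Prop :=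
  on12 r \o on23 r \o on12 r =1 on23 r \o on12 r \o on23 r.

Definition is_solution (X : Type) (r : X * X -> X * X) : Prop :=
  [/\ bijective r, forall x, bijective (lam_of r x),
      forall y, bijective (rho_of r y) & yang_baxter r].

Record solution : Type := Solution {
  carrier :> Type;
  braiding : carrier * carrier -> carrier * carrier;
  carrier_inhabited : inhabited carrier;
  braidingP : is_solution braiding }.

Notation lam S := (lam_of (@braiding S)).
Notation rho S := (rho_of (@braiding S)).

Section Quotient.
Variables (T : Type) (R : T -> T -> Prop) (eqR : Equivalence R).

Let e (x y : {classic T}) : bool := `[< R x y >].

Lemma quot_refl : reflexive e.
Proof. by move=> x; apply/asboolP; reflexivity. Qed.
Lemma quot_sym : symmetric e.
Proof. by move=> x y; apply: asbool_equiv_eq; split=> ?; symmetry. Qed.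
Lemma quot_trans : transitive e.
Proof.
by move=> y x z /asboolP xy /asboolP yz; apply/asboolP; transitivity y.
Qed.

Definition quot_rel : equiv_rel {classic T} :=
  EquivRel e quot_refl quot_sym quot_trans.

Definition quot : Type := {eq_quot quot_rel}.
HB.instance Definition _ := Choice.on quot.

Definition cls (x : T) : quot := \pi_({eq_quot quot_rel}) (x : {classic T}).
Definition rep (q : quot) : T := repr (q : {eq_quot quot_rel}).

Lemma repK q : cls (rep q) = q.
Proof. exact: reprK. Qed.

Lemma clsP x y : cls x = cls y <-> R x y.
Proof. by split=> [/eqquotP/asboolP|xy] //; apply/eqquotP/asboolP. Qed.

Lemma cls_rep x : R (rep (cls x)) x.
Proof. by apply/clsP; rewrite repK. Qed.

Lemma quot_ind (P : quot -> Prop) : (forall x, P (cls x)) -> forall q, P q.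
Proof. by move=> Px q; rewrite -[q]repK. Qed.
End Quotient.

Definition braided (A : Type) (L P : A -> A -> A) : Prop :=
  [/\ forall x y z, L x (L y z) = L (L x y) (L (P y x) z),
      forall x y z, P (L (P y x) z) (L x y) = L (P (L y z) x) (P z y)
    & forall x y z, P z (P y x) = P (P z y) (P (L y z) x)].

Lemma braidedC A (L P : A -> A -> A) : braided L P -> braided P L.
Proof. by case=> h1 h2 h3; split=> x y z. Qed.

Lemma yang_baxterP A (r : A * A -> A * A) :
  yang_baxter r <-> braided (lam_of r) (rho_of r).
Proof.
have E12 x y z : on12 r (x, y, z) = (lam_of r x y, rho_of r y x, z).
  by rewrite /lam_of /rho_of /=; case: (r _).
have E23 x y z : on23 r (x, y, z) = (x, lam_of r y z, rho_of r z y).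
  by rewrite /lam_of /rho_of /=; case: (r _).
split=> [h|[h1 h2 h3] [[x y] z]]; last first.
  by rewrite /comp !(E12, E23) -h1 h2 h3.
by split=> x y z; have := h (x, y, z); rewrite /comp !(E12, E23) => -[].
Qed.

(* LV x and PV y invert L x and P y, and (R1, R2) inverts (x, y) |-> (L x y,  *)
(* P y x).                                                                    *)
Record birack (A : Type) (L P LV PV R1 R2 : A -> A -> A) : Prop := Birack {
  birack_br : braided L P;
  LK : forall x, cancel (L x) (LV x);
  LVK : forall x, cancel (LV x) (L x);
  PK : forall x, cancel (P x) (PV x);
  PVK : forall x, cancel (PV x) (P x);
  R1K : forall x y, R1 (L x y) (P y x) = x;
  R2K : forall x y, R2 (L x y) (P y x) = y;
  LRK : forall a b, L (R1 a b) (R2 a b) = a;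
  PRK : forall a b, P (R2 a b) (R1 a b) = b }.

Lemma birackC A (L P LV PV R1 R2 : A -> A -> A) :
  birack L P LV PV R1 R2 ->
  birack P L PV LV (fun a b => R2 b a) (fun a b => R1 b a).
Proof. by case=> b *; split=> //; apply: braidedC. Qed.

Lemma bij_inv A B (f : A -> B) :
  bijective f -> {g : B -> A | cancel f g /\ cancel g f}.
Proof. by move=> bf; apply: cid; case: bf => g fK gK; exists g. Qed.

Definition lamV (S : solution) (x : S) : S -> S :=
  let: And4 _ bl _ _ := braidingP S in sval (bij_inv (bl x)).
Definition rhoV (S : solution) (y : S) : S -> S :=
  let: And4 _ _ br _ := braidingP S in sval (bij_inv (br y)).
Definition braidingV (S : solution) : S * S -> S * S :=
  let: And4 b _ _ _ := braidingP S in sval (bij_inv b).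

Lemma solution_birack (S : solution) :
  birack (lam S) (rho S) (@lamV S) (@rhoV S)
    (lam_of (@braidingV S)) (fun a b => rho_of (@braidingV S) b a).
Proof.
rewrite /lamV /rhoV /braidingV; case: (braidingP S) => b bl br yb.
case: (bij_inv b) => s [/= rK sK].
split; first exact/yang_baxterP.
- by move=> x; case: (bij_inv (bl x)) => g [].
- by move=> x; case: (bij_inv (bl x)) => g [].
- by move=> x; case: (bij_inv (br x)) => g [].
- by move=> x; case: (bij_inv (br x)) => g [].
- by move=> x y; rewrite /lam_of /rho_of -surjective_pairing rK.
- by move=> x y; rewrite /lam_of /rho_of -surjective_pairing rK.
- by move=> x y; rewrite /lam_of /rho_of -surjective_pairing sK.
- by move=> x y; rewrite /lam_of /rho_of -surjective_pairing sK.
Qed.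

Lemma solution_braided (S : solution) : braided (lam S) (rho S).
Proof. exact: birack_br (solution_birack S). Qed.

Lemma birack_inv A (L P LV PV R1 R2 : A -> A -> A) :
  birack L P LV PV R1 R2 -> braided R1 (fun a b => R2 b a).
Proof.
move=> bk; have /yang_baxterP yb : braided
  (lam_of (fun p => (L p.1 p.2, P p.2 p.1)))
  (rho_of (fun p => (L p.1 p.2, P p.2 p.1))) := birack_br bk.
set r := fun p => _ in yb.
pose s (p : A * A) := (R1 p.1 p.2, R2 p.1 p.2).
have sK : cancel s r by case=> a b; rewrite /r /s /= (LRK bk) (PRK bk).
have rK : cancel r s by case=> a b; rewrite /r /s /= (R1K bk) (R2K bk).
suff /yang_baxterP : yang_baxter s by [].
have s12 : cancel (on12 s) (on12 r).
  move=> [[x y] z]; rewrite /on12; have := sK (x, y).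
  by case: (s _) => a b ->.
have s23 : cancel (on23 s) (on23 r).
  move=> [[x y] z]; rewrite /on23; have := sK (y, z).
  by case: (s _) => a b ->.
have r12 : cancel (on12 r) (on12 s).
  move=> [[x y] z]; rewrite /on12; have := rK (x, y).
  by case: (r _) => a b ->.
have r23 : cancel (on23 r) (on23 s).
  move=> [[x y] z]; rewrite /on23; have := rK (y, z).
  by case: (r _) => a b ->.
move=> t; have := yb (on12 s (on23 s (on12 s t))).
rewrite /comp s12 s23 s12 => /(congr1 (fun t => on23 s (on12 s (on23 s t)))).
by rewrite r23 r12 r23.
Qed.

Section Retract.
Variable S : solution.
Let bk := solution_birack S.
Let br := solution_braided S.

Definition retr (x y : S) : Prop := lam S x = lam S y /\ rho S x = rho S y.

#[global] Instance retr_equiv : Equivalence retr.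
Proof.
split=> [x|x y []|x y z [h1 h2] [h3 h4]]; first by [].
  by split.
by split; [rewrite h1|rewrite h2].
Qed.

Definition ret_carrier : Type := quot retr_equiv.

Definition ret_braiding (p : ret_carrier * ret_carrier) :
    ret_carrier * ret_carrier :=
  let x := rep p.1 in let y := rep p.2 in
  (cls retr_equiv (lam S x y), cls retr_equiv (rho S y x)).

Lemma lam_lam_rho (x y : S) :
  lam S (lam S x y) =1 lam S x \o lam S y \o lamV (rho S y x).
Proof. by case: br => h1 _ _ z /=; rewrite h1 (LVK bk). Qed.

Lemma rho_rho_lam (x y : S) :
  rho S (rho S y x) =1 rho S y \o rho S x \o rhoV (lam S x y).
Proof. by case: br => _ _ h3 z /=; rewrite [RHS]h3 (PVK bk). Qed.

Lemma lam_rho (x y : S) :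
  lam S (rho S y x) =1 lamV (lam S x y) \o lam S x \o lam S y.
Proof. by case: br => h1 _ _ z /=; rewrite h1 (LK bk). Qed.

Lemma rho_lam (x y : S) :
  rho S (lam S x y) =1 rhoV (rho S y x) \o rho S y \o rho S x.
Proof. by case: br => _ _ h3 z /=; rewrite h3 (PK bk). Qed.

Lemma retr_lamV_eq (y z z' : S) :
  rho S (lam S y z) = rho S (lam S y z') -> rho S z y = rho S z' y.
Proof.
move=> e; case: br => _ h2 _; set x := rhoV y y.
have xE : rho S y x = y by exact: (PVK bk).
have := h2 x y z; have := h2 x y z'; rewrite xE e => -> e'.
exact: (can_inj (LK bk _)) (esym e').
Qed.

Lemma retr_rhoV_eq (y z z' : S) :
  lam S (rho S y z) = lam S (rho S y z') -> lam S z y = lam S z' y.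
Proof.
move=> e; case: br => _ h2 _; set x := lamV y y.
have xE : lam S y x = y by exact: (LVK bk).
have := h2 z y x; have := h2 z' y x; rewrite xE e => <- e'.
exact: (can_inj (PK bk _)) e'.
Qed.

Lemma retr_lamI (x y y' : S) : retr (lam S x y) (lam S x y') -> retr y y'.
Proof.
case=> e1 e2; have e3 := retr_lamV_eq e2; case: br => h1 _ h3.
split; apply: funext => z.
  by apply: (can_inj (LK bk x)); rewrite (h1 x y) (h1 x y') e1 e3.
by rewrite -[z](PVK bk x) (h3 _ x y) (h3 _ x y') e2 e3.
Qed.

Lemma retr_rhoI (x y y' : S) : retr (rho S x y) (rho S x y') -> retr y y'.
Proof.
case=> e1 e2; have e3 := retr_rhoV_eq e1; case: br => h1 _ h3.
split; apply: funext => z.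
  by rewrite -[z](LVK bk x) (h1 y x) (h1 y' x) e1 e3.
by apply: (can_inj (PK bk x)); rewrite (h3 _ y x) (h3 _ y' x) e2 e3.
Qed.

Lemma retr_lam (x x' y y' : S) :
  retr x x' -> retr y y' -> retr (lam S x y) (lam S x' y').
Proof.
case=> xl xr [yl yr]; rewrite xl; split; apply: funext => z.
  by rewrite !lam_lam_rho /= yl yr.
by rewrite !rho_lam /= yr.
Qed.

Lemma retr_rho (x x' y y' : S) :
  retr x x' -> retr y y' -> retr (rho S y x) (rho S y' x').
Proof.
case=> xl xr [yl yr]; rewrite yr; split; apply: funext => z.
  by rewrite !lam_rho /= xl.
by rewrite !rho_rho_lam /= xl xr.
Qed.

Notation cl := (cls retr_equiv).

Lemma ret_braidingE (x y : S) :
  ret_braiding (cl x, cl y) = (cl (lam S x y), cl (rho S y x)).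
Proof.
by congr pair; apply/clsP; [apply: retr_lam|apply: retr_rho]; apply: cls_rep.
Qed.

Lemma ret_lamE (x y : S) : lam_of ret_braiding (cl x) (cl y) = cl (lam S x y).
Proof. by rewrite /lam_of ret_braidingE. Qed.

Lemma ret_rhoE (x y : S) : rho_of ret_braiding (cl y) (cl x) = cl (rho S y x).
Proof. by rewrite /rho_of ret_braidingE. Qed.

Lemma inj_surj_bij A B (f : A -> B) :
  injective f -> (forall y, exists x, f x = y) -> bijective f.
Proof.
move=> fI fS; have [g gP] := choice fS.
by exists g => // x; apply: fI; rewrite gP.
Qed.

Lemma retr_braiding_inj (x y x' y' : S) :
  retr (lam S x y) (lam S x' y') -> retr (rho S y x) (rho S y' x') ->
  retr x x' /\ retr y y'.
Proof.
move=> ra rb; pose y2 := lamV x (lam S x' y').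
have y2E : lam S x y2 = lam S x' y' by exact: (LVK bk).
have yy2 : retr y y2 by apply: (@retr_lamI x); rewrite y2E.
have r2E : rho S y2 x = rho S y x.
  by apply: esym; apply: retr_lamV_eq; rewrite y2E; case: ra.
pose x3 := rhoV y2 (rho S y' x').
have x3E : rho S y2 x3 = rho S y' x' by exact: (PVK bk).
have xx3 : retr x x3 by apply: (@retr_rhoI y2); rewrite x3E r2E.
have l3E : lam S x3 y2 = lam S x y2.
  by apply: esym; apply: retr_rhoV_eq; rewrite x3E r2E; case: rb.
have e1 : x3 = x'.
  by rewrite -(R1K bk x3 y2) l3E x3E y2E (R1K bk).
have e2 : y2 = y'.
  by rewrite -(R2K bk x3 y2) l3E x3E y2E (R2K bk).
by rewrite -e1 -e2.
Qed.

Lemma ret_is_solution : is_solution ret_braiding.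
Proof.
split.
- apply: inj_surj_bij => [[p q] [p' q']|[p q]].
    elim/quot_ind: p => x; elim/quot_ind: q => y.
    elim/quot_ind: p' => x'; elim/quot_ind: q' => y'.
    rewrite !ret_braidingE => -[/clsP h1 /clsP h2].
    by have [h3 h4] := retr_braiding_inj h1 h2; congr pair; apply/clsP.
  elim/quot_ind: p => a; elim/quot_ind: q => b.
  exists (cl (lam_of (@braidingV S) a b), cl (rho_of (@braidingV S) b a)).
  by rewrite ret_braidingE (LRK bk) (PRK bk).
- elim/quot_ind => x; apply: inj_surj_bij => [p q|].
    elim/quot_ind: p => y; elim/quot_ind: q => z.
    by rewrite !ret_lamE => /clsP/retr_lamI/clsP.
  by elim/quot_ind=> y; exists (cl (lamV x y)); rewrite ret_lamE (LVK bk).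
- elim/quot_ind => x; apply: inj_surj_bij => [p q|].
    elim/quot_ind: p => y; elim/quot_ind: q => z.
    by rewrite !ret_rhoE => /clsP/retr_rhoI/clsP.
  by elim/quot_ind=> y; exists (cl (rhoV x y)); rewrite ret_rhoE (PVK bk).
apply/yang_baxterP; case: br => h1 h2 h3.
split; elim/quot_ind=> x; elim/quot_ind=> y; elim/quot_ind=> z.
- by rewrite !(ret_lamE, ret_rhoE) h1.
- by rewrite !(ret_lamE, ret_rhoE) h2.
- by rewrite !(ret_lamE, ret_rhoE) h3.
Qed.

Lemma ret_inhabited : inhabited ret_carrier.
Proof. by case: (carrier_inhabited S) => x; exists; exact: cl x. Qed.

Definition Ret : solution := Solution ret_inhabited ret_is_solution.
End Retract.

Definition one_element (T : Type) : Prop := exists x : T, forall y : T, y = x.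

Definition multipermutation_level (S : solution) (m : nat) : Prop :=
  one_element (iter m Ret S) /\
  (forall k, k < m -> ~ one_element (iter k Ret S)).

Definition finite_multipermutation_level (S : solution) : Prop :=
  exists m, multipermutation_level S m.

Section Presentation.
Variables (A : Type) (Rl : seq A -> seq A -> Prop).

(* The smallest congruence of the free monoid containing Rl. *)
Inductive cong : seq A -> seq A -> Prop :=
| cong_rel p s u v of Rl u v : cong (p ++ u ++ s) (p ++ v ++ s)
| cong_refl u : cong u u
| cong_sym u v of cong u v : cong v u
| cong_trans u v w of cong u v & cong v w : cong u w.

#[global] Instance cong_equiv : Equivalence cong.
Proof.
split; [exact: cong_refl | exact: cong_sym | exact: cong_trans].
Qed.

Lemma cong_base u v : Rl u v -> cong u v.
Proof. by move=> /(cong_rel [::] [::]); rewrite !cats0. Qed.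

Lemma cong_catl p u v : cong u v -> cong (p ++ u) (p ++ v).
Proof.
elim=> {u v} [p' s u v uv||u v _ +|u v w _ + _]; last exact: cong_trans.
- by rewrite !(catA p); apply: cong_rel.
- by move=> u; apply: cong_refl.
- exact: cong_sym.
Qed.

Lemma cong_catr s u v : cong u v -> cong (u ++ s) (v ++ s).
Proof.
elim=> {u v} [p' s' u v uv||u v _ +|u v w _ + _]; last exact: cong_trans.
- by rewrite -!catA; apply: cong_rel.
- by move=> u; apply: cong_refl.
- exact: cong_sym.
Qed.

Lemma cong_cat u u' v v' : cong u u' -> cong v v' -> cong (u ++ v) (u' ++ v').
Proof. by move=> /(cong_catr v) h /(cong_catl u'); apply: cong_trans. Qed.

Definition presented : Type := quot cong_equiv.
HB.instance Definition _ := Choice.on presented.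

Definition word (u : seq A) : presented := cls cong_equiv u.

Lemma pres_ind (Q : presented -> Prop) :
  (forall u, Q (word u)) -> forall q, Q q.
Proof. exact: quot_ind. Qed.

Definition pres_mul (p q : presented) : presented := word (rep p ++ rep q).

Lemma pres_mulE u v : pres_mul (word u) (word v) = word (u ++ v).
Proof. by apply/clsP; apply: cong_cat; apply: cls_rep. Qed.

Lemma presA : associative pres_mul.
Proof.
move=> p q s; elim/pres_ind: p => u; elim/pres_ind: q => v.
by elim/pres_ind: s => w; rewrite !pres_mulE catA.
Qed.
Lemma pres1m : left_id (word [::]) pres_mul.
Proof. by move=> p; elim/pres_ind: p => u; rewrite pres_mulE. Qed.
Lemma presm1 : right_id (word [::]) pres_mul.
Proof. by move=> p; elim/pres_ind: p => u; rewrite pres_mulE cats0. Qed.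

HB.instance Definition _ := isMonoid.Build presented presA pres1m presm1.

Lemma word0 : word [::] = 1%g. Proof. by []. Qed.

Lemma wordM u v : word (u ++ v) = (word u * word v)%g.
Proof. by rewrite -pres_mulE. Qed.

Lemma word_cons a u : word (a :: u) = (word [:: a] * word u)%g.
Proof. exact: (wordM [:: a]). Qed.

Lemma wordP u v : word u = word v <-> cong u v.
Proof. exact: clsP. Qed.
End Presentation.

Section Words.
Variables (A : Type) (L P : A -> A -> A).

(* lambda_x(y_1 ... y_l) for a letter x *)
Fixpoint lamw (x : A) (v : seq A) : seq A :=
  if v is y :: v' then L x y :: lamw (P y x) v' else [::].

(* rho_(y_1 ... y_l)(x) = rho_(y_l) (... rho_(y_1)(x)) for a letter x *)
Definition rhow (v : seq A) (x : A) : A := foldl (fun z y => P y z) x v.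

Definition lamW (u v : seq A) : seq A := foldr lamw v u.

(* rho_v(x_1 u') = rho_(lambda_u'(v))(x_1) rho_v(u') *)
Fixpoint rhoW (v u : seq A) : seq A :=
  if u is x :: u' then rhow (lamW u' v) x :: rhoW v u' else [::].

Lemma lamw_cat x u v : lamw x (u ++ v) = lamw x u ++ lamw (rhow u x) v.
Proof. by elim: u x => //= y u IH x; rewrite IH. Qed.

Lemma rhow_cat u v x : rhow (u ++ v) x = rhow v (rhow u x).
Proof. by rewrite /rhow foldl_cat. Qed.

Lemma lamW_cat u v w : lamW (u ++ v) w = lamW u (lamW v w).
Proof. by rewrite /lamW foldr_cat. Qed.

Lemma lamW0 u : lamW u [::] = [::].
Proof. by elim: u => //= x u ->. Qed.

Lemma rhoW_catr v u u' :
  rhoW v (u ++ u') = rhoW (lamW u' v) u ++ rhoW v u'.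
Proof. by elim: u => //= x u ->; rewrite lamW_cat. Qed.

Lemma lamW_catr u v w : lamW u (v ++ w) = lamW u v ++ lamW (rhoW v u) w.
Proof. by elim: u => //= x u ->; rewrite lamw_cat. Qed.

Lemma rhoW0 u : rhoW [::] u = u.
Proof. by elim: u => //= x u ->; rewrite lamW0. Qed.

Lemma rhoW_cat v v' u : rhoW (v ++ v') u = rhoW v' (rhoW v u).
Proof. by elim: u => //= x u ->; rewrite lamW_catr rhow_cat. Qed.

Lemma lamW_seq1 u y : lamW u [:: y] = [:: foldr L y u].
Proof. by elim: u => //= x u ->. Qed.

Lemma lamW_cons u y v :
  lamW u (y :: v) = foldr L y u :: lamW (rhoW [:: y] u) v.
Proof. by rewrite (lamW_catr u [:: y]) lamW_seq1. Qed.

End Words.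

Lemma rhoW1_rcons A (L P : A -> A -> A) y u x :
  rhoW L P [:: y] (rcons u x) = rcons (rhoW L P [:: L x y] u) (P y x).
Proof. by rewrite -cats1 rhoW_catr /= cats1. Qed.

Lemma rhoW1_rev A (L P : A -> A -> A) y u :
  rhoW L P [:: y] u = rev (lamw P L y (rev u)).
Proof.
elim/last_ind: u y => //= u x IH y.
by rewrite rhoW1_rcons IH rev_rcons /= rev_cons.
Qed.

Lemma foldr_rhow A (L : A -> A -> A) y u : foldr L y u = rhow L (rev u) y.
Proof. by rewrite /rhow foldl_rev. Qed.

Definition revrel A (Rl : seq A -> seq A -> Prop) u v := Rl (rev u) (rev v).

Lemma cong_revrel A (Rl : seq A -> seq A -> Prop) u v :
  cong Rl u v -> cong (revrel Rl) (rev u) (rev v).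
Proof.
elim=> {u v} [p s u v uv|u|u v _|u v w _ + _].
- rewrite !rev_cat -!catA; apply: cong_rel; rewrite /revrel !revK //.
- exact: cong_refl.
- exact: cong_sym.
- exact: cong_trans.
Qed.

Lemma cong_revrelV A (Rl : seq A -> seq A -> Prop) u v :
  cong (revrel Rl) u v -> cong Rl (rev u) (rev v).
Proof.
elim=> {u v} [p s u v uv|u|u v _|u v w _ + _].
- rewrite !rev_cat -!catA; exact: cong_rel.
- exact: cong_refl.
- exact: cong_sym.
- exact: cong_trans.
Qed.

Section Stable.
Variables (A : Type).
Implicit Types (L P : A -> A -> A) (Rl : seq A -> seq A -> Prop).

Definition stable L P Rl := forall x u v, Rl u v ->
  Rl (lamw L P x u) (lamw L P x v) /\ rhow P u x = rhow P v x.

Lemma stable_cong L P Rl : stable L P Rl -> forall u v, cong Rl u v ->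
  forall x, cong Rl (lamw L P x u) (lamw L P x v) /\ rhow P u x = rhow P v x.
Proof.
move=> st u v; elim=> {u v} [p s u v uv|u|u v _ IH|u v w _ IH _ IH'] x.
- have [h1 h2] := st (rhow P p x) _ _ uv.
  rewrite !lamw_cat !rhow_cat h2; split=> //; exact: cong_rel.
- by split=> //; apply: cong_refl.
- by have [h1 h2] := IH x; split; rewrite ?h2 //; apply: cong_sym.
- have [h1 h2] := IH x; have [h3 h4] := IH' x; split; last by rewrite h2.
  exact: cong_trans h1 h3.
Qed.

Lemma stable_congr L P Rl : stable P L (revrel Rl) ->
  forall u v, cong Rl u v -> forall x,
  cong Rl (rhoW L P [:: x] u) (rhoW L P [:: x] v) /\ foldr L x u = foldr L x v.
Proof.
move=> st u v /cong_revrel/(stable_cong st) h x; have [h1 h2] := h x.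
by rewrite !rhoW1_rev !foldr_rhow h2; split=> //; apply: cong_revrelV.
Qed.

Section Two.
Variables (L P : A -> A -> A) (Rl : seq A -> seq A -> Prop).
Hypotheses (stL : stable L P Rl) (stR : stable P L (revrel Rl)).

Lemma cong_lamWl u v w : cong Rl u v -> lamW L P u w = lamW L P v w.
Proof.
elim: w u v => [|x w IH] u v uv; first by rewrite !lamW0.
have [h1 h2] := stable_congr stR uv x.
by rewrite !lamW_cons h2 (IH _ _ h1).
Qed.

Lemma cong_lamWr u v w : cong Rl v w -> cong Rl (lamW L P u v) (lamW L P u w).
Proof.
by move=> vw; elim: u => //= x u IH; have [] := stable_cong stL IH x.
Qed.

Lemma cong_rhoWl u v w : cong Rl u v -> rhoW L P u w = rhoW L P v w.
Proof.
move=> uv; elim: w => //= x w ->; congr cons.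
by have [] := stable_cong stL (cong_lamWr w uv) x.
Qed.

Lemma cong_rhoWr u v w : cong Rl v w -> cong Rl (rhoW L P u v) (rhoW L P u w).
Proof.
elim: u v w => [|x u IH] v w vw; first by rewrite !rhoW0.
by rewrite !(rhoW_cat _ _ [:: x] u); apply: IH; have [] := stable_congr stR vw x.
Qed.

Lemma cong_lamW u u' v v' : cong Rl u u' -> cong Rl v v' ->
  cong Rl (lamW L P u v) (lamW L P u' v').
Proof. by move=> /cong_lamWl -> /cong_lamWr. Qed.

Lemma cong_rhoW u u' v v' : cong Rl u u' -> cong Rl v v' ->
  cong Rl (rhoW L P v u) (rhoW L P v' u').
Proof. by move=> uu' vv'; rewrite (cong_rhoWl _ vv'); apply: cong_rhoWr. Qed.
End Two.
End Stable.

(* The map r(p, q) = (lambda_p(q), rho_q(p)) induced on a presented monoid.   *)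
(* It is meaningful when L and P are compatible with the relations; this is   *)
(* [cong_lamW] and [cong_rhoW].                                               *)
Definition pres_braiding A (L P : A -> A -> A) (Rl : seq A -> seq A -> Prop)
    (t : presented Rl * presented Rl) : presented Rl * presented Rl :=
  let u := rep t.1 in let v := rep t.2 in
  (word Rl (lamW L P u v), word Rl (rhoW L P v u)).

Section PresBraiding.
Variables (A : Type) (L P : A -> A -> A) (Rl : seq A -> seq A -> Prop).
Hypotheses (stL : stable L P Rl) (stR : stable P L (revrel Rl)).
Notation r := (@pres_braiding A L P Rl).

Lemma pres_lamE u v :
  lam_of r (word Rl u) (word Rl v) = word Rl (lamW L P u v).
Proof.
by apply/wordP; apply: cong_lamW => //; apply: cls_rep.
Qed.

Lemma pres_rhoE u v :
  rho_of r (word Rl v) (word Rl u) = word Rl (rhoW L P v u).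
Proof.
by apply/wordP; apply: cong_rhoW => //; apply: cls_rep.
Qed.

Local Open Scope group_scope.

Lemma pres_lam1 p : lam_of r 1 p = p.
Proof. by elim/pres_ind: p => u; rewrite -word0 pres_lamE. Qed.

Lemma pres_lamM p q s : lam_of r (p * q) s = lam_of r p (lam_of r q s).
Proof.
elim/pres_ind: p => u; elim/pres_ind: q => v; elim/pres_ind: s => w.
by rewrite -wordM !pres_lamE lamW_cat.
Qed.

Lemma pres_rho1 p : rho_of r 1 p = p.
Proof. by elim/pres_ind: p => u; rewrite -word0 pres_rhoE rhoW0. Qed.

Lemma pres_rhoM p q s : rho_of r (p * q) s = rho_of r q (rho_of r p s).
Proof.
elim/pres_ind: p => u; elim/pres_ind: q => v; elim/pres_ind: s => w.
by rewrite -wordM !pres_rhoE rhoW_cat.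
Qed.

Lemma pres_lam_1 p : lam_of r p 1 = 1.
Proof. by elim/pres_ind: p => u; rewrite -word0 pres_lamE lamW0. Qed.

Lemma pres_lam_M p q s :
  lam_of r p (q * s) = lam_of r p q * lam_of r (rho_of r q p) s.
Proof.
elim/pres_ind: p => u; elim/pres_ind: q => v; elim/pres_ind: s => w.
by rewrite -wordM pres_rhoE !pres_lamE lamW_catr wordM.
Qed.

Lemma pres_rho_1 p : rho_of r p 1 = 1.
Proof. by elim/pres_ind: p => u; rewrite -word0 pres_rhoE. Qed.

Lemma pres_rho_M p q s :
  rho_of r p (q * s) = rho_of r (lam_of r s p) q * rho_of r p s.
Proof.
elim/pres_ind: p => u; elim/pres_ind: q => v; elim/pres_ind: s => w.
by rewrite -wordM pres_lamE !pres_rhoE rhoW_catr wordM.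
Qed.

Lemma pres_lam_gen a b : lam_of r (word Rl [:: a]) (word Rl [:: b]) =
  word Rl [:: L a b].
Proof. exact: pres_lamE. Qed.

Lemma pres_rho_gen a b : rho_of r (word Rl [:: b]) (word Rl [:: a]) =
  word Rl [:: P b a].
Proof. exact: pres_rhoE. Qed.

Lemma presented_ind (Q : presented Rl -> Prop) : Q 1 ->
  (forall a p, Q p -> Q (word Rl [:: a] * p)) -> forall p, Q p.
Proof.
move=> Q1 QM; elim/pres_ind=> u; elim: u => [|a u IH]; first exact: Q1.
by rewrite word_cons; apply: QM.
Qed.

Lemma pres_mul_braid :
  (forall a b, cong Rl [:: a; b] [:: L a b; P b a]) ->
  forall p q : presented Rl, p * q = lam_of r p q * rho_of r q p.
Proof.
move=> h.
have h1 a (q : presented Rl) : word Rl [:: a] * q =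
    lam_of r (word Rl [:: a]) q * rho_of r q (word Rl [:: a]).
  move: q a; apply: presented_ind => [a|b q IH a].
    by rewrite pres_lam_1 pres_rho1 mulg1 mul1g.
  rewrite pres_lam_M pres_rhoM -mulgA pres_rho_gen -IH pres_lam_gen !mulgA.
  by congr mul; rewrite -!wordM; apply/wordP; exact: h.
apply: presented_ind => [q|a p IH q].
  by rewrite pres_lam1 pres_rho_1 mulg1 mul1g.
by rewrite pres_lamM pres_rho_M !mulgA -h1 -!mulgA -IH.
Qed.
End PresBraiding.

Inductive monoid_rel (A : Type) (L P : A -> A -> A) : seq A -> seq A -> Prop :=
  MonoidRel x y : monoid_rel L P [:: x; y] [:: L x y; P y x].

Lemma monoid_relE A (L P : A -> A -> A) x y a b :
  a = L x y -> b = P y x -> monoid_rel L P [:: x; y] [:: a; b].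
Proof. by move=> -> ->. Qed.

Lemma monoid_rel_stable A (L P : A -> A -> A) :
  braided L P -> stable L P (monoid_rel L P).
Proof.
case=> h1 h2 h3.
by move=> b _ _ [x y] /=; split; [apply: monoid_relE|].
Qed.

Section MonoidRel.
Variables (A : Type) (L P LV PV R1 R2 : A -> A -> A).
Hypothesis bk : birack L P LV PV R1 R2.

(* The words lambda_b^-1(v), read off the grid. *)
Lemma monoid_rel_stableV :
  stable LV (fun y b => P (LV b y) b) (monoid_rel L P).
Proof.
have [h1 h2 h3] := birack_br bk.
move=> b _ _ [x y] /=.
set x' := LV b x; set c := P x' b; set y' := LV c y.
have Ex : L b x' = x by exact: (LVK bk).
have Ey : L c y' = y by exact: (LVK bk).
have E1 : LV b (L x y) = L x' y'.
  by rewrite -[in RHS](LK bk b (L x' y')) h1 Ex -/c Ey.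
rewrite E1.
have E2 : LV (P (L x' y') b) (P y x) = P y' x'.
  by rewrite -Ey -Ex h2 (LK bk).
by rewrite E2 -h3; split=> //; apply: MonoidRel.
Qed.

Lemma lamw_LVK b : cancel (lamw L P b) (lamw LV (fun y b => P (LV b y) b) b).
Proof. by move=> v; elim: v b => //= y v IH b; rewrite (LK bk) IH. Qed.

Lemma lamw_LK b : cancel (lamw LV (fun y b => P (LV b y) b) b) (lamw L P b).
Proof. by move=> v; elim: v b => //= y v IH b; rewrite (LVK bk) IH. Qed.
End MonoidRel.

Lemma stable_iff A (L P : A -> A -> A) (Q Q' : seq A -> seq A -> Prop) :
  (forall u v, Q u v <-> Q' u v) -> stable L P Q -> stable L P Q'.
Proof. by move=> e st x u v /e/(st x) [h1 h2]; split=> //; apply/e. Qed.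

Lemma monoid_rel_rev A (L P : A -> A -> A) u v :
  monoid_rel P L u v <-> revrel (monoid_rel L P) u v.
Proof.
split=> [[x y]|]; first exact: MonoidRel.
rewrite /revrel -{2}[u]revK -{2}[v]revK.
by case=> x y; apply: MonoidRel.
Qed.

Section WordBraid.
Variables (A : Type) (L P : A -> A -> A).
Hypothesis br : braided L P.
Notation Rl := (monoid_rel L P).

Lemma monoid_rel_stableC : stable P L (revrel Rl).
Proof.
apply: stable_iff (monoid_rel_stable (braidedC br)); exact: monoid_rel_rev.
Qed.

Let stL := monoid_rel_stable br.
Let stR := monoid_rel_stableC.

Lemma cong_word u v : cong Rl (u ++ v) (lamW L P u v ++ rhoW L P v u).
Proof.
apply/wordP; rewrite !wordM -pres_lamE // -pres_rhoE //.
by apply: pres_mul_braid => // a b; apply: cong_base; apply: MonoidRel.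
Qed.

Lemma lamW_braid u v w :
  lamW L P u (lamW L P v w) = lamW L P (lamW L P u v) (lamW L P (rhoW L P v u) w).
Proof. by rewrite -!lamW_cat; apply: cong_lamWl (cong_word u v). Qed.

Lemma rhoW_braid u v w :
  rhoW L P w (rhoW L P v u) =
  rhoW L P (rhoW L P w v) (rhoW L P (lamW L P v w) u).
Proof. by rewrite -!rhoW_cat; apply: cong_rhoWl (cong_word v w). Qed.

Definition braid2 u v w := rhoW L P (lamW L P (rhoW L P v u) w) (lamW L P u v) =
  lamW L P (rhoW L P (lamW L P v w) u) (rhoW L P w v).

Lemma braid2_l u u' v w :
  braid2 u (lamW L P u' v) (lamW L P (rhoW L P v u') w) -> braid2 u' v w ->
  braid2 (u ++ u') v w.
Proof.
rewrite /braid2 !rhoW_catr !lamW_cat => -> h.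
by rewrite -lamW_braid -h.
Qed.

Lemma braid2_r u v w w' :
  braid2 u v w -> braid2 (rhoW L P (lamW L P v w) u) (rhoW L P w v) w' ->
  braid2 u v (w ++ w').
Proof.
rewrite /braid2 !lamW_catr !rhoW_cat => h h'.
by rewrite h -h' rhoW_braid.
Qed.

Lemma braid2_m u v v' w :
  braid2 u v (lamW L P v' w) -> braid2 (rhoW L P v u) v' w ->
  braid2 u (v ++ v') w.
Proof.
rewrite /braid2 !(lamW_catr, rhoW_cat, rhoW_catr, lamW_cat) => h ->.
by rewrite -h -lamW_braid rhoW_braid.
Qed.

Lemma lamW_braid2 u v w : braid2 u v w.
Proof.
have [_ h2 _] := br.
elim: u v w => [|x u IHu] v w; first by [].
apply: (@braid2_l [:: x]); last exact: IHu.
move: (lamW L P u v) (lamW _ _ _ w) => {IHu}v {}w.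
elim: w x v => [|z w IHw] x v; first by rewrite /braid2 !lamW0 !rhoW0.
apply: (@braid2_r _ _ [:: z]); last exact: IHw.
move: x {IHw}; elim: v => [|y v IHv] x; first by [].
apply: (@braid2_m _ [:: y]); last exact: IHv.
by rewrite lamW_seq1 /braid2 /= h2.
Qed.
End WordBraid.

Lemma pres_map_bij A (Rl : seq A -> seq A -> Prop) (f g : seq A -> seq A)
    (F : presented Rl -> presented Rl) :
  (forall u, F (word Rl u) = word Rl (f u)) ->
  (forall u v, cong Rl u v -> cong Rl (g u) (g v)) ->
  cancel f g -> cancel g f -> bijective F.
Proof.
move=> FE gc fK gK; have GE u : word Rl (g (rep (word Rl u))) = word Rl (g u).
  by apply/wordP; apply: gc; apply: cls_rep.
exists (fun q => word Rl (g (rep q))) => q; elim/pres_ind: q => u.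
  by rewrite FE GE fK.
by rewrite GE FE gK.
Qed.

Lemma words_inv A (L P L' P' : A -> A -> A) :
  (forall x y, L' (L x y) (P y x) = x) -> (forall x y, P' (P y x) (L x y) = y) ->
  forall u v, lamW L' P' (lamW L P u v) (rhoW L P v u) = u /\
              rhoW L' P' (rhoW L P v u) (lamW L P u v) = v.
Proof.
move=> hL hP.
have h a w : foldr L' (rhow P w a) (lamw L P a w) = a /\
             rhoW L' P' [:: rhow P w a] (lamw L P a w) = w.
  elim: w a => //= y w IH a; have [h1 h2] := IH (P y a).
  by rewrite h1 h2 lamW_seq1 h1 hL /= hP.
elim=> [|a u IH] v; first by rewrite lamW0 rhoW0.
have [h1 h2] := h a (lamW L P u v); have [h3 h4] := IH v.
by rewrite [rhoW L P _ _]/= [lamW L P _ _]/= lamW_cons h1 h2 h3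
           (rhoW_cat _ _ [:: _]) h2 h4.
Qed.

Lemma stable_sym A (L P : A -> A -> A) Rl :
  stable L P Rl -> stable L P (fun u v => Rl v u).
Proof. by move=> st x u v /(st x) [h1 h2]. Qed.

Section StructureMonoid.
Variable S : solution.
Let bk := solution_birack S.
Let br := solution_braided S.
Notation Rl := (monoid_rel (lam S) (rho S)).

Definition structure_monoid : Type := presented Rl.
HB.instance Definition _ := Monoid.on structure_monoid.

Definition monoid_braiding :
    structure_monoid * structure_monoid -> structure_monoid * structure_monoid :=
  @pres_braiding S (lam S) (rho S) Rl.

Let stL : stable (lam S) (rho S) Rl := monoid_rel_stable br.
Let stR : stable (rho S) (lam S) (revrel Rl) := monoid_rel_stableC br.

Lemma monoid_mul_braid (p q : presented Rl) :
  (p * q)%g = (lam_of monoid_braiding p q * rho_of monoid_braiding q p)%g.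
Proof.
by apply: pres_mul_braid => // a b; apply: cong_base; apply: MonoidRel.
Qed.

Lemma monoid_braided :
  braided (lam_of monoid_braiding) (rho_of monoid_braiding).
Proof.
have lE := pres_lamE stL stR; have rE := pres_rhoE stL stR.
split; apply: pres_ind => u; apply: pres_ind => v; apply: pres_ind => w.
- rewrite (lE v w) (lE u v) (rE u v) (lE u (lamW _ _ v w)).
  rewrite (lE (rhoW _ _ v u) w) (lE (lamW _ _ u v) (lamW _ _ _ w)).
  by congr word; apply: lamW_braid.
- rewrite (rE u v) (lE u v) (lE v w) (rE v w) (lE (rhoW _ _ v u) w).
  rewrite (rE (lamW _ _ u v)) (rE u) (lE (rhoW _ _ _ u)).
  by congr word; apply: lamW_braid2.
- rewrite (rE u v) (rE v w) (lE v w) (rE (rhoW _ _ v u)) (rE u).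
  rewrite (rE (rhoW _ _ _ u)).
  by congr word; apply: rhoW_braid.
Qed.

Lemma monoid_lam_bij p : bijective (lam_of monoid_braiding p).
Proof.
elim/pres_ind: p => u; elim: u => [|a u IH].
  by exists id => q; exact: pres_lam1.
have bij1 : bijective (lam_of monoid_braiding (word Rl [:: a])).
  apply: (pres_map_bij (pres_lamE stL stR [:: a])) (lamw_LVK bk a) (lamw_LK bk a).
  by move=> v w vw; have [] := stable_cong (monoid_rel_stableV bk) vw a.
apply: (eq_bij (bij_comp bij1 IH)) => q.
by rewrite (word_cons Rl a u); symmetry; exact: (pres_lamM stL stR).
Qed.

Lemma monoid_rho_bij p : bijective (rho_of monoid_braiding p).
Proof.
have bk' := birackC bk.
elim/pres_ind: p => u; elim: u => [|a u IH].
  by exists id => q; exact: pres_rho1.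
have bij1 : bijective (rho_of monoid_braiding (word Rl [:: a])).
  apply: (@pres_map_bij _ _ (rhoW (lam S) (rho S) [:: a])
    (fun u => rev (lamw (@rhoV S) (fun y b => lam S (rhoV b y) b) a (rev u)))).
  - by move=> v; exact: (pres_rhoE stL stR).
  - move=> v w /cong_revrel vw; apply: cong_revrelV.
    have st := stable_iff (@monoid_rel_rev _ _ _) (monoid_rel_stableV bk').
    by have [] := stable_cong st vw a.
  - by move=> v; rewrite rhoW1_rev revK (lamw_LVK bk') revK.
  - by move=> v; rewrite rhoW1_rev revK (lamw_LK bk') revK.
apply: (eq_bij (bij_comp IH bij1)) => q.
by rewrite (word_cons Rl a u); symmetry; exact: (pres_rhoM stL stR).
Qed.

Lemma monoid_braiding_bij : bijective monoid_braiding.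
Proof.
pose s := @braidingV S.
have br' : braided (lam_of s) (rho_of s) := birack_inv bk.
have RlE u v : monoid_rel (lam_of s) (rho_of s) v u <-> Rl u v.
  split=> -[x y]; apply: monoid_relE.
  - by rewrite (LRK bk).
  - by rewrite (PRK bk).
  - by rewrite (R1K bk).
  - by rewrite (R2K bk).
have stL' : stable (lam_of s) (rho_of s) Rl.
  exact: stable_iff RlE (stable_sym (monoid_rel_stable br')).
have stR' : stable (rho_of s) (lam_of s) (revrel Rl).
  apply: stable_iff (stable_sym (monoid_rel_stableC br')) => u v.
  exact: RlE.
pose t := @pres_braiding S (lam_of s) (rho_of s) Rl.
have rE u v : monoid_braiding (word Rl u, word Rl v) =
    (word Rl (lamW (lam S) (rho S) u v), word Rl (rhoW (lam S) (rho S) v u)).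
  by rewrite [LHS]surjective_pairing -(pres_lamE stL stR) -(pres_rhoE stL stR).
have tE u v : t (word Rl u, word Rl v) =
    (word Rl (lamW (lam_of s) (rho_of s) u v),
     word Rl (rhoW (lam_of s) (rho_of s) v u)).
  by rewrite [LHS]surjective_pairing -(pres_lamE stL' stR') -(pres_rhoE stL' stR').
exists t => -[p q]; move: p q; apply: pres_ind => u; apply: pres_ind => v.
  rewrite rE tE; have [] := @words_inv _ (lam S) (rho S) (lam_of s) (rho_of s)
    (R1K bk) (R2K bk) u v.
  by move=> -> ->.
rewrite tE rE; have [] := @words_inv _ (lam_of s) (rho_of s) (lam S) (rho S)
  (LRK bk) (PRK bk) u v.
by move=> -> ->.
Qed.

Lemma monoid_is_solution : is_solution monoid_braiding.
Proof.
split; [exact: monoid_braiding_bij|exact: monoid_lam_bij|exact: monoid_rho_bij|].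
exact/yang_baxterP/monoid_braided.
Qed.

Definition monoid_solution : solution :=
  Solution (inhabits (1%g : structure_monoid)) monoid_is_solution.
End StructureMonoid.

(* [Inv x] is the formal inverse of the generator [Gen x]. *)
Variant letter (A : Type) : Type := Gen of A | Inv of A.

Definition letter_inv A (a : letter A) : letter A :=
  match a with Gen x => Inv x | Inv x => Gen x end.

Inductive group_rel (A : Type) (L P : A -> A -> A) :
    seq (letter A) -> seq (letter A) -> Prop :=
| GroupRel x y : group_rel L P [:: Gen x; Gen y] [:: Gen (L x y); Gen (P y x)]
| GroupInvr x : group_rel L P [:: Gen x; Inv x] [::]
| GroupInvl x : group_rel L P [:: Inv x; Gen x] [::].

Section Letters.
Variables (A : Type) (L P LV PV R1 R2 : A -> A -> A).

(* The actions of the letters on the letters are forced by                    *)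
(*   lambda_(x^-1) = lambda_x^-1,  rho_(y^-1) = rho_y^-1,                      *)
(*   1 = lambda_a(b b^-1) = lambda_a(b) lambda_(rho_b(a))(b^-1),              *)
(*   1 = rho_b(a^-1 a) = rho_(lambda_a(b))(a^-1) rho_b(a);                    *)
(* lambda_(x^-1)(y^-1) = u^-1 and rho_(y^-1)(x^-1) = v^-1, where r(v, u) =    *)
(* (y, x).                                                                    *)
Definition letter_lam (a b : letter A) : letter A :=
  match a, b with
  | Gen x, Gen y => Gen (L x y)
  | Inv x, Gen y => Gen (LV x y)
  | Gen x, Inv y => Inv (L (PV y x) y)
  | Inv x, Inv y => Inv (R2 y x)
  end.

Definition letter_rho (b a : letter A) : letter A :=
  match b, a with
  | Gen y, Gen x => Gen (P y x)
  | Inv y, Gen x => Gen (PV y x)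
  | Gen y, Inv x => Inv (P (LV x y) x)
  | Inv y, Inv x => Inv (R1 y x)
  end.

Hypothesis bk : birack L P LV PV R1 R2.

Lemma letter_lam_inv a c :
  letter_lam (letter_rho a c) (letter_inv a) = letter_inv (letter_lam c a).
Proof.
case: c a => x [] y /=; rewrite ?(PK bk) //.
  by rewrite -{1}[y](LVK bk x) (R2K bk).
by rewrite -{2}[y](LRK bk y x) (LK bk).
Qed.

Lemma letter_rho_inv a c : letter_rho (letter_inv a) (letter_rho a c) = c.
Proof.
case: c a => x [] y /=; rewrite ?(PK bk, PVK bk) //.
  by rewrite -{1}[y](LVK bk x) (R1K bk).
by rewrite -{2}[y](LRK bk y x) (LK bk) (PRK bk).
Qed.

Lemma group_rel_inv a : group_rel L P [:: a; letter_inv a] [::].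
Proof. by case: a => x; constructor. Qed.

Lemma group_rel_gen u v : monoid_rel L P u v ->
  group_rel L P (map (@Gen A) u) (map (@Gen A) v).
Proof. by case=> x y; apply: GroupRel. Qed.

Lemma letter_lamw_gen b v :
  lamw letter_lam letter_rho (Gen b) (map (@Gen A) v) =
    map (@Gen A) (lamw L P b v) /\
  rhow letter_rho (map (@Gen A) v) (Gen b) = Gen (rhow P v b).
Proof.
elim: v b => //= y v IH b; have [h1 h2] := IH (P y b).
by rewrite h1 h2.
Qed.

Lemma letter_lamw_inv b v :
  lamw letter_lam letter_rho (Inv b) (map (@Gen A) v) =
    map (@Gen A) (lamw LV (fun y b => P (LV b y) b) b v) /\
  rhow letter_rho (map (@Gen A) v) (Inv b) =
    Inv (rhow (fun y b => P (LV b y) b) v b).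
Proof.
elim: v b => //= y v IH b; have [h1 h2] := IH (P (LV b y) b).
by rewrite h1 h2.
Qed.

Lemma group_rel_stable : stable letter_lam letter_rho (group_rel L P).
Proof.
have cancels c a :
    group_rel L P (lamw letter_lam letter_rho c [:: a; letter_inv a]) [::] /\
    rhow letter_rho [:: a; letter_inv a] c = c.
  by rewrite /= letter_lam_inv letter_rho_inv; split=> //; apply: group_rel_inv.
have gens c u v : monoid_rel L P u v ->
    group_rel L P (lamw letter_lam letter_rho c (map (@Gen A) u))
      (lamw letter_lam letter_rho c (map (@Gen A) v)) /\
    rhow letter_rho (map (@Gen A) u) c = rhow letter_rho (map (@Gen A) v) c.
  case: c => c uv.
    have [-> ->] := letter_lamw_gen c u; have [-> ->] := letter_lamw_gen c v.
    have [h1 ->] := monoid_rel_stable (birack_br bk) c uv.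
    by split=> //; apply: group_rel_gen.
  have [-> ->] := letter_lamw_inv c u; have [-> ->] := letter_lamw_inv c v.
  have [h1 ->] := monoid_rel_stableV bk c uv.
  by split=> //; apply: group_rel_gen.
move=> c u v [x y|x|x].
- exact: (gens c _ _ (MonoidRel L P x y)).
- exact: (cancels c (Gen x)).
- exact: (cancels c (Inv x)).
Qed.
End Letters.

Lemma group_rel_rev A (L P : A -> A -> A) u v :
  group_rel P L u v <-> revrel (group_rel L P) u v.
Proof.
split=> [[x y|x|x]|]; try by constructor.
rewrite /revrel -{2}[u]revK -{2}[v]revK.
by case=> [x y|x|x]; constructor.
Qed.

Lemma letter_lamC A (P LV PV R1 : A -> A -> A) :
  letter_lam P PV LV (fun a b => R1 b a) = letter_rho P LV PV R1.
Proof. by apply: funext => -[] a; apply: funext => -[]. Qed.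

Lemma letter_rhoC A (L LV PV R2 : A -> A -> A) :
  letter_rho L PV LV (fun a b => R2 b a) = letter_lam L LV PV R2.
Proof. by apply: funext => -[] a; apply: funext => -[]. Qed.

Lemma group_rel_stableC A (L P LV PV R1 R2 : A -> A -> A) :
  birack L P LV PV R1 R2 ->
  stable (letter_rho P LV PV R1) (letter_lam L LV PV R2)
    (revrel (group_rel L P)).
Proof.
move=> bk; have := group_rel_stable (birackC bk).
rewrite letter_lamC letter_rhoC; apply: stable_iff; exact: group_rel_rev.
Qed.

Section StructureGroup.
Variable S : solution.
Let bk := solution_birack S.
Notation Rl := (group_rel (lam S) (rho S)).
Local Open Scope group_scope.

Definition structure_group : Type := presented Rl.
HB.instance Definition _ := Monoid.on structure_group.

Notation wd u := (word Rl u : structure_group).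

Definition inv_word (u : seq (letter S)) : seq (letter S) :=
  rev (map (@letter_inv S) u).

Definition group_inv (g : structure_group) : structure_group :=
  wd (inv_word (rep g)).

Lemma letter_invK : involutive (@letter_inv S).
Proof. by case. Qed.

Lemma word_invr a : wd [:: a; letter_inv a] = 1.
Proof. by apply/wordP/cong_base; apply: group_rel_inv. Qed.

Lemma word_mul_inv u : wd (u ++ inv_word u) = 1.
Proof.
elim: u => //= a u IH.
rewrite /inv_word /= rev_cons -cats1 -/(inv_word u) -cat1s.
by rewrite wordM catA wordM IH mul1g -wordM word_invr.
Qed.

Lemma word_inv_mul u : wd (inv_word u ++ u) = 1.
Proof.
have {2}-> : u = inv_word (inv_word u); last exact: word_mul_inv.
rewrite /inv_word map_rev revK -map_comp -[LHS]map_id.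
by apply: eq_map => a; rewrite /= letter_invK.
Qed.

Lemma group_mulVg : left_inverse 1 group_inv (@mul structure_group).
Proof. by move=> g; rewrite -{2}[g]repK -wordM word_inv_mul. Qed.

Lemma group_mulgV : right_inverse 1 group_inv (@mul structure_group).
Proof. by move=> g; rewrite -{1}[g]repK -wordM word_mul_inv. Qed.

HB.instance Definition _ := hasInv.Build structure_group group_inv.
HB.instance Definition _ :=
  Monoid_isGroup.Build structure_group group_mulVg group_mulgV.

Notation LL := (letter_lam (lam S) (@lamV S) (@rhoV S)
  (fun a b => rho_of (@braidingV S) b a)).
Notation PP := (letter_rho (rho S) (@lamV S) (@rhoV S) (lam_of (@braidingV S))).

Definition group_braiding :
    structure_group * structure_group -> structure_group * structure_group :=
  @pres_braiding (letter S) LL PP Rl.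

Let stL : stable LL PP Rl := group_rel_stable bk.
Let stR : stable PP LL (revrel Rl) := group_rel_stableC bk.
Notation lg := (lam_of group_braiding).
Notation rg := (rho_of group_braiding).

Lemma word_Inv x : wd [:: Inv x] = (wd [:: Gen x])^-1.
Proof.
apply: (@mulIg structure_group (wd [:: Gen x])).
by rewrite mulVg -wordM; apply/wordP/cong_base; constructor.
Qed.

Lemma word_gen x y :
  wd [:: Gen x] * wd [:: Gen y] =
  wd [:: Gen (lam S x y)] * wd [:: Gen (rho S y x)].
Proof. by rewrite -!wordM; apply/wordP/cong_base; constructor. Qed.

Lemma group_letter_braid a b : cong Rl [:: a; b] [:: LL a b; PP b a].
Proof.
suff E : wd [:: a] * wd [:: b] = wd [:: LL a b] * wd [:: PP b a].
  by apply/wordP; rewrite [LHS](wordM _ [:: a]) [RHS](wordM _ [:: LL a b]).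
case: a b => x [] y /=; rewrite ?word_Inv.
- exact: word_gen.
- apply: (@mulIg structure_group (wd [:: Gen y])).
  rewrite mulgVK; set z := rhoV y x.
  apply: (@mulgI structure_group (wd [:: Gen (lam S z y)])).
  by rewrite !mulgA mulgV mul1g (word_gen z y) /z (PVK bk).
- set u := lamV x y; have <- : lam S x u = y by exact: (LVK bk).
  apply: (@mulgI structure_group (wd [:: Gen x])).
  apply: (@mulIg structure_group (wd [:: Gen (rho S u x)])).
  by rewrite !mulgA mulgV mul1g mulgVK (word_gen x u).
- by rewrite -!invgM (word_gen (lam_of (@braidingV S) y x)) (LRK bk) (PRK bk).
Qed.

Lemma group_mul_braid (g h : structure_group) : g * h = lg g h * rg h g.
Proof. by apply: pres_mul_braid => // a b; apply: group_letter_braid. Qed.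

Let lM (g h k : structure_group) : lg (g * h) k = lg g (lg h k) :=
  pres_lamM stL stR g h k.
Let rM (g h k : structure_group) : rg (g * h) k = rg h (rg g k) :=
  pres_rhoM stL stR g h k.
Let l1 (g : structure_group) : lg 1 g = g := pres_lam1 stL stR g.
Let r1 (g : structure_group) : rg 1 g = g := pres_rho1 stL stR g.
Let l_1 (g : structure_group) : lg g 1 = 1 := pres_lam_1 stL stR g.
Let r_1 (g : structure_group) : rg g 1 = 1 := pres_rho_1 stL stR g.
Let l_M (g h k : structure_group) : lg g (h * k) = lg g h * lg (rg h g) k :=
  pres_lam_M stL stR g h k.
Let r_M (g h k : structure_group) : rg g (h * k) = rg (lg k g) h * rg g k :=
  pres_rho_M stL stR g h k.

Lemma group_braided : braided lg rg.
Proof.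
have h1 x y z : lg x (lg y z) = lg (lg x y) (lg (rg y x) z).
  by rewrite -!lM -group_mul_braid.
split=> x y z; first exact: h1.
  have := congr1 (lg x) (group_mul_braid y z).
  rewrite !l_M (group_mul_braid (lg x y)) -h1.
  exact: mulgI.
by rewrite -!rM -group_mul_braid.
Qed.

Lemma group_lam_bij g : bijective (lg g).
Proof. by exists (lg g^-1) => h; rewrite -lM ?mulVg ?mulgV l1. Qed.

Lemma group_rho_bij g : bijective (rg g).
Proof. by exists (rg g^-1) => h; rewrite -rM ?mulVg ?mulgV r1. Qed.

Lemma group_lamV g h : lg (rg h g) h^-1 = (lg g h)^-1.
Proof.
by apply: (@mulgI structure_group (lg g h)); rewrite -l_M !mulgV l_1.
Qed.

Lemma group_rhoV g h : rg (lg g h) g^-1 = (rg h g)^-1.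
Proof.
by apply: (@mulIg structure_group (rg h g)); rewrite -r_M !mulVg r_1.
Qed.

Lemma group_braiding_bij : bijective group_braiding.
Proof.
pose i (p : structure_group * structure_group) := (p.2^-1, p.1^-1).
have iK : involutive i by case=> g h; rewrite /i /= !invgK.
have K p : i (group_braiding (i (group_braiding p))) = p.
  case: p => g h.
  suff E : group_braiding (i (lg g h, rg h g)) = i (g, h).
    by rewrite [group_braiding (g, h)]surjective_pairing E iK.
  have E1 : lg (rg h g)^-1 (lg g h)^-1 = h^-1.
    by rewrite -group_lamV -lM mulVg l1.
  have E2 : rg (lg g h)^-1 (rg h g)^-1 = g^-1.
    by rewrite -group_rhoV -rM mulgV r1.
  by rewrite [LHS]surjective_pairing; congr pair.
exists (i \o group_braiding \o i) => p; first exact: K.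
by rewrite /= -[LHS]iK K iK.
Qed.

Lemma group_is_solution : is_solution group_braiding.
Proof.
split; [exact: group_braiding_bij|exact: group_lam_bij|exact: group_rho_bij|].
exact/yang_baxterP/group_braided.
Qed.

Definition group_solution : solution :=
  Solution (inhabits (1 : structure_group)) group_is_solution.
End StructureGroup.

Section Generators.
Variable S : solution.
Local Open Scope group_scope.

Definition monoid_gen (x : S) : structure_monoid S := word _ [:: x].
Definition group_gen (x : S) : structure_group S := word _ [:: Gen x].

Lemma monoid_gen_rel (x y : S) :
  monoid_gen x * monoid_gen y =
  monoid_gen (lam S x y) * monoid_gen (rho S y x).
Proof. by rewrite -!wordM; apply/wordP/cong_base; constructor. Qed.

Lemma group_gen_rel (x y : S) :
  group_gen x * group_gen y = group_gen (lam S x y) * group_gen (rho S y x).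
Proof. exact: word_gen. Qed.

Lemma monoid_braiding_gen (x y : S) :
  monoid_braiding (monoid_gen x, monoid_gen y) =
  (monoid_gen (lam S x y), monoid_gen (rho S y x)).
Proof.
have stL := monoid_rel_stable (solution_braided S).
have stR := monoid_rel_stableC (solution_braided S).
rewrite [LHS]surjective_pairing; congr pair.
  exact: (pres_lam_gen stL stR).
exact: (pres_rho_gen stL stR).
Qed.

Lemma group_braiding_gen (x y : S) :
  group_braiding (group_gen x, group_gen y) =
  (group_gen (lam S x y), group_gen (rho S y x)).
Proof.
have stL := group_rel_stable (solution_birack S).
have stR := group_rel_stableC (solution_birack S).
rewrite [LHS]surjective_pairing; congr pair.
  exact: (pres_lam_gen stL stR (Gen x) (Gen y)).
exact: (pres_rho_gen stL stR (Gen x) (Gen y)).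
Qed.
End Generators.

(* Main.v *)
(* Write x ~_n y when x and y have the same image in Ret^n.  Then             *)
(* x ~_(n+1) y means lambda_x(z) ~_n lambda_y(z) and rho_x(z) ~_n rho_y(z)    *)
(* for all z, and the level is finite iff some ~_m is total.                  *)
(* From X to M or G: two words whose letters are ~_n-related one by one (with *)
(* equal signs, for G) are ~_n-related, by induction on n.  If ~_m is total   *)
(* on X, then w ~_m lambda_u(w) and w ~_m rho_u(w) because the actions        *)
(* preserve the length and the signs of w; hence ~_(m+1) is total.            *)
(* Back to X: the canonical map from X to M or G only identifies points that  *)
(* are ~_1-related, so ~_n between images gives ~_(n+1) in X.                 *)
From mathcomp Require Import all_boot boolp.
Require Import Defs.

(** By [projSP], each ~_n can be tested on elements of the original solution, without handling
    iterated quotients. On the way up, M and G are treated alike by [proj_word] and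
    [word_finite_level]: it is enough that the action of a letter modulo ~_n depends only on its
    class modulo ~_(n+1). For generators this is [projSP]. For formal inverses it rests on
    [letter_retr_lam] and [letter_retr_rho], applied in Ret^n(X); they can be carried there because
    morphisms commute with all the inverse operations. On the way down, [finite_level_preimage]
    serves any morphism whose fibres lie inside retract classes. *)

(** * Morphisms and the inverse operations *)

Section Morphism.
Variables (S T : solution) (f : S -> T).

Definition morphism : Prop :=
  (forall x y, f (lam S x y) = lam T (f x) (f y)) /\
  (forall x y, f (rho S y x) = rho T (f y) (f x)).

Hypothesis fM : morphism.
Let bS := solution_birack S.
Let bT := solution_birack T.

Lemma morph_lamV x y : f (lamV x y) = lamV (f x) (f y).
Proof. by apply: (can_inj (LK bT (f x))); rewrite -fM.1 (LVK bS) (LVK bT). Qed.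

Lemma morph_rhoV x y : f (rhoV x y) = rhoV (f x) (f y).
Proof. by apply: (can_inj (PK bT (f x))); rewrite -fM.2 (PVK bS) (PVK bT). Qed.

Lemma morph_braidingV1 a b :
  f (lam_of (@braidingV S) a b) = lam_of (@braidingV T) (f a) (f b).
Proof.
by have := R1K bT (f (lam_of (@braidingV S) a b)) (f (rho_of (@braidingV S) b a));
  rewrite -fM.1 -fM.2 (LRK bS) (PRK bS).
Qed.

Lemma morph_braidingV2 a b :
  f (rho_of (@braidingV S) b a) = rho_of (@braidingV T) (f b) (f a).
Proof.
by have := R2K bT (f (lam_of (@braidingV S) a b)) (f (rho_of (@braidingV S) b a));
  rewrite -fM.1 -fM.2 (LRK bS) (PRK bS).
Qed.
End Morphism.

(** * Iterated retracts as equivalences on the original solution *)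

Section IteratedRetract.
Variable S : solution.

Fixpoint proj n : S -> iter n Ret S :=
  if n is k.+1 then fun x => cls (retr_equiv (iter k Ret S)) (proj k x) else id.

Lemma proj_morphism n : morphism S (iter n Ret S) (proj n).
Proof.
elim: n => //= n [IHl IHr].
by split=> x y; [rewrite IHl; exact/esym/ret_lamE|rewrite IHr; exact/esym/ret_rhoE].
Qed.

Lemma proj_surj n q : exists x, proj n x = q.
Proof.
elim: n q => [|n IH] q; first by exists q.
by elim/quot_ind: q => p; have [x <-] := IH p; exists x.
Qed.

Lemma projS_retr n x y :
  proj n.+1 x = proj n.+1 y <-> retr (proj n x) (proj n y).
Proof. exact: clsP. Qed.

(** Every point of Ret^n is the image of some [z], so equality of the maps on Ret^n can be tested on
    elements of [S]. *)
Lemma projSP n x y : proj n.+1 x = proj n.+1 y <->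
  forall z, proj n (lam S x z) = proj n (lam S y z) /\
            proj n (rho S x z) = proj n (rho S y z).
Proof.
have [fl fr] := proj_morphism n.
rewrite projS_retr; split=> [[el er] z|h].
  by rewrite !fl !fr el er.
split; apply: funext => p; have [z <-] := proj_surj n p;
  by have [] := h z; rewrite !fl !fr.
Qed.

Lemma finite_levelP : finite_multipermutation_level S <->
  exists n, forall x y, proj n x = proj n y.
Proof.
have oneP n : one_element (iter n Ret S) <-> forall x y, proj n x = proj n y.
  split=> [[q qP] x y|h]; first by rewrite (qP (proj n x)) (qP (proj n y)).
  case: (carrier_inhabited S) => x; exists (proj n x) => q.
  by have [y <-] := proj_surj n q.
split=> [[m [/oneP h _]]|[n]]; first by exists m.
move=> /oneP; elim/ltn_ind: n => n IH h.
have [[k [kn hk]]|no] := pselect (exists k, k < n /\ one_element (iter k Ret S)).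
  exact: IH kn hk.
by exists n; split=> // k kn hk; apply: no; exists k.
Qed.
End IteratedRetract.

(** In [T] it suffices to test on the points [j z], so [j] need not be onto. The level shifts by one
    because at n = 0 equal images only give [retr]. *)
Lemma finite_level_preimage (S T : solution) (j : S -> T) :
  morphism S T j -> (forall x y, j x = j y -> retr x y) ->
  finite_multipermutation_level T -> finite_multipermutation_level S.
Proof.
move=> [jl jr] jI /finite_levelP [n hn]; apply/finite_levelP; exists n.+1.
move=> x y; have := hn (j x) (j y); elim: n {hn} x y => [|n IH] x y.
  by move=> /jI h; apply/projS_retr.
move=> /projSP h; apply/projSP => z; have [hl hr] := h (j z).
by split; apply: IH; rewrite ?jl ?jr.
Qed.

(** * Actions on words whose letters are taken modulo an equivalence *)

Section WordMap.
Variables (A B : Type) (L P : A -> A -> A) (L' P' : B -> B -> B) (f : A -> B).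
Hypothesis fL : forall x y, f (L x y) = L' (f x) (f y).
Hypothesis fP : forall x y, f (P y x) = P' (f y) (f x).

Lemma map_lamw x v : map f (lamw L P x v) = lamw L' P' (f x) (map f v).
Proof. by elim: v x => //= y v IH x; rewrite IH fL fP. Qed.

Lemma map_rhow v x : f (rhow P v x) = rhow P' (map f v) (f x).
Proof. by elim: v x => //= y v IH x; rewrite IH fP. Qed.

Lemma map_lamW u v : map f (lamW L P u v) = lamW L' P' (map f u) (map f v).
Proof. by elim: u => //= x u IH; rewrite map_lamw IH. Qed.

Section Refinement.
Variables (C : Type) (L'' P'' : C -> C -> C) (g : A -> C).
Hypothesis gL : forall x y, g (L x y) = L'' (g x) (g y).
Hypothesis gP : forall x y, g (P y x) = P'' (g y) (g x).
Hypothesis gfL : forall a a' b, g a = g a' -> f (L a b) = f (L a' b).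
Hypothesis gfP : forall a a' b, g a = g a' -> f (P a b) = f (P a' b).

(** After passing [y], the acting letter becomes [P y x], whose [g]-class depends only on that of
    [x]; so [gfL] applies again at each letter. *)
Lemma refine_lamw x x' v :
  g x = g x' -> map f (lamw L P x v) = map f (lamw L P x' v).
Proof.
elim: v x x' => //= y v IH x x' xx'; rewrite (gfL _ _ _ xx') (IH _ (P y x')) //.
by rewrite !gP xx'.
Qed.

Lemma refine_rhow v v' x :
  map g v = map g v' -> f (rhow P v x) = f (rhow P v' x).
Proof.
elim: v v' x => [|y v IH] [|y' v'] x //= [yy' vv'].
by rewrite (IH _ _ vv') map_rhow (gfP _ _ _ yy') -map_rhow.
Qed.

Lemma refine_lamW u u' v :
  map g u = map g u' -> map f (lamW L P u v) = map f (lamW L P u' v).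
Proof.
elim: u u' => [|x u IH] [|x' u'] //= [xx' uu'].
by rewrite (refine_lamw _ _ _ xx') map_lamw (IH _ uu') -map_lamw.
Qed.
End Refinement.
End WordMap.

(** A letter of the acted word meets [u] already transformed by the letters to its right; [g]
    respects both operations, so the two transforms still agree modulo [g]. *)
Lemma refine_rhoW (A B C : Type) (L P : A -> A -> A) (P' : B -> B -> B)
    (L'' P'' : C -> C -> C) (f : A -> B) (g : A -> C) :
  (forall x y, f (P y x) = P' (f y) (f x)) ->
  (forall x y, g (L x y) = L'' (g x) (g y)) ->
  (forall x y, g (P y x) = P'' (g y) (g x)) ->
  (forall a a' b, g a = g a' -> f (P a b) = f (P a' b)) ->
  forall u u' v, map g u = map g u' ->
  map f (rhoW L P u v) = map f (rhoW L P u' v).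
Proof.
move=> fP gL gP gfP u u' v uu'; elim: v => //= x v ->; congr cons.
apply: (refine_rhow _ _ _ _ _ fP _ _ gfP).
by rewrite !(map_lamW _ _ _ _ _ _ _ gL gP) uu'.
Qed.

(* T is M or G and [wd] maps a word to its class; [f n] reduces letters       *)
(* modulo ~_n.                                                                *)
Section WordSolution.
Variables (A : Type) (L P : A -> A -> A) (T : solution) (wd : seq A -> T).
Hypothesis wdL : forall u v, lam T (wd u) (wd v) = wd (lamW L P u v).
Hypothesis wdP : forall u v, rho T (wd v) (wd u) = wd (rhoW L P v u).
Hypothesis wd_surj : forall p, exists u, wd u = p.
Variables (B : nat -> Type) (L' P' : forall n, B n -> B n -> B n).
Variable f : forall n, A -> B n.
Hypothesis fL : forall n x y, f n (L x y) = L' n (f n x) (f n y).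
Hypothesis fP : forall n x y, f n (P y x) = P' n (f n y) (f n x).
Hypothesis f0 : injective (f 0).
Hypothesis fSL : forall n a a' b,
  f n.+1 a = f n.+1 a' -> f n (L a b) = f n (L a' b).
Hypothesis fSP : forall n a a' b,
  f n.+1 a = f n.+1 a' -> f n (P a b) = f n (P a' b).

Lemma proj_word n u u' :
  map (f n) u = map (f n) u' -> proj T n (wd u) = proj T n (wd u').
Proof.
elim: n u u' => [|n IH] u u'; first by move=> /(inj_map f0) ->.
move=> uu'; apply/projSP => p; have [w <-] := wd_surj p.
rewrite !wdL !wdP; split; apply: IH.
  exact: (refine_lamW _ _ _ _ _ _ _ (fL n) (fP n) _ _ _ (fP n.+1) (fSL n)).
exact: (refine_rhoW _ _ _ _ _ _ _ _ _ _ (fP n) (fL n.+1) (fP n.+1) (fSP n)).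
Qed.

(** The actions must fix classes modulo [f m], but [f m] need not be constant: in G it still sees
    the sign of a letter. Any two elements then move a test word to words with the same letters
    modulo [f m]. *)
Lemma word_finite_level m :
  (forall a b, f m (L a b) = f m b) -> (forall a b, f m (P a b) = f m b) ->
  finite_multipermutation_level T.
Proof.
move=> tL tP; apply/finite_levelP; exists m.+1.
have lw x v : map (f m) (lamw L P x v) = map (f m) v.
  by elim: v x => //= y v IH x; rewrite IH tL.
have lW u v : map (f m) (lamW L P u v) = map (f m) v.
  by elim: u => //= x u IH; rewrite lw.
have rw v x : f m (rhow P v x) = f m x.
  by elim: v x => //= y v IH x; rewrite IH tP.
have rW v u : map (f m) (rhoW L P v u) = map (f m) u.
  by elim: u => //= x u ->; rewrite rw.
move=> p q; apply/projSP => s.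
have [u <-] := wd_surj p; have [v <-] := wd_surj q; have [w <-] := wd_surj s.
by rewrite !wdL !wdP; split; apply: proj_word; rewrite ?lW ?rW.
Qed.
End WordSolution.

(** * Signed letters and the retract relation *)

Section LetterActions.
Variable S : solution.

Definition sol_letter_lam : letter S -> letter S -> letter S :=
  letter_lam (lam S) (@lamV S) (@rhoV S)
    (fun a b => rho_of (@braidingV S) b a).

Definition sol_letter_rho : letter S -> letter S -> letter S :=
  letter_rho (rho S) (@lamV S) (@rhoV S) (lam_of (@braidingV S)).

Variant letter_retr : letter S -> letter S -> Prop :=
| RetrGen x y of retr x y : letter_retr (Gen x) (Gen y)
| RetrInv x y of retr x y : letter_retr (Inv x) (Inv y).

Let bk := solution_birack S.

Lemma retr_lamV x y : retr x y -> @lamV S x = lamV y.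
Proof.
move=> [el _]; apply: funext => z; apply: (can_inj (LK bk x)).
by rewrite (LVK bk) el (LVK bk).
Qed.

Lemma retr_rhoV x y : retr x y -> @rhoV S x = rhoV y.
Proof.
move=> [_ er]; apply: funext => z; apply: (can_inj (PK bk x)).
by rewrite (PVK bk) er (PVK bk).
Qed.

(** Let r(x, y) = (a, b) and lambda_x(y') = a'. As rho_a = rho_a', [retr_lamV_eq] gives rho_y'(x) =
    b, so r(x, y') = (a', b) with the same [x]. *)
Lemma retr_braidingV1 a a' b :
  retr a a' -> lam_of (@braidingV S) a b = lam_of (@braidingV S) a' b.
Proof.
move=> [_ er]; set x := LHS; pose y := rho_of (@braidingV S) b a.
pose y' := lamV x a'.
have aE : lam S x y = a by exact: (LRK bk).
have bE : rho S y x = b by exact: (PRK bk).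
have aE' : lam S x y' = a' by exact: (LVK bk).
have bE' : rho S y' x = b.
  by rewrite -bE; apply: retr_lamV_eq; rewrite aE aE' er.
by rewrite -aE' -bE' (R1K bk).
Qed.

Lemma retr_braidingV2 a b b' :
  retr b b' -> rho_of (@braidingV S) b a = rho_of (@braidingV S) b' a.
Proof.
move=> [el _]; set y := LHS; pose x := lam_of (@braidingV S) a b.
pose x' := rhoV y b'.
have aE : lam S x y = a by exact: (LRK bk).
have bE : rho S y x = b by exact: (PRK bk).
have bE' : rho S y x' = b' by exact: (PVK bk).
have aE' : lam S x' y = a.
  by rewrite -aE; apply: retr_rhoV_eq; rewrite bE bE' el.
by rewrite -aE' -bE' (R2K bk).
Qed.

Lemma letter_retr_lam a a' b :
  letter_retr a a' -> sol_letter_lam a b = sol_letter_lam a' b.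
Proof.
case=> x y xy; case: b => z /=.
- by rewrite xy.1.
(* [Gen x] acts on [Inv z] through [rhoV z x], so the relation is pulled back along the bijection
   rho_z. *)
- have [-> //] : retr (rhoV z x) (rhoV z y).
  by apply: (@retr_rhoI _ z); rewrite !(PVK bk).
- by rewrite (retr_lamV _ _ xy).
- by rewrite (retr_braidingV2 _ _ _ xy).
Qed.

Lemma letter_retr_rho a a' b :
  letter_retr a a' -> sol_letter_rho a b = sol_letter_rho a' b.
Proof.
case=> x y xy; case: b => z /=.
- by rewrite xy.2.
- have [_ -> //] : retr (lamV z x) (lamV z y).
  by apply: (@retr_lamI _ z); rewrite !(LVK bk).
- by rewrite (retr_rhoV _ _ xy).
- by rewrite (retr_braidingV1 _ _ _ xy).
Qed.
End LetterActions.

Definition letter_map {A B : Type} (f : A -> B) (a : letter A) : letter B :=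
  match a with Gen x => Gen (f x) | Inv x => Inv (f x) end.

Section LetterMap.
Variables (S T : solution) (f : S -> T).
Hypothesis fM : morphism S T f.

Lemma letter_map_lam a b : letter_map f (sol_letter_lam S a b) =
  sol_letter_lam T (letter_map f a) (letter_map f b).
Proof.
case: a b => x [] y /=; congr (_ _).
- by rewrite fM.1.
- by rewrite fM.1 morph_rhoV.
- by rewrite morph_lamV.
- by rewrite morph_braidingV2.
Qed.

Lemma letter_map_rho a b : letter_map f (sol_letter_rho S b a) =
  sol_letter_rho T (letter_map f b) (letter_map f a).
Proof.
case: b a => x [] y /=; congr (_ _).
- by rewrite fM.2.
- by rewrite fM.2 morph_lamV.
- by rewrite morph_rhoV.
- by rewrite morph_braidingV1.
Qed.
End LetterMap.

Lemma letter_retr_proj (S : solution) n (a a' : letter S) :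
  letter_map (proj S n.+1) a = letter_map (proj S n.+1) a' ->
  letter_retr _ (letter_map (proj S n) a) (letter_map (proj S n) a').
Proof. by case: a a' => x [] y // [/projS_retr h]; constructor. Qed.

(** * From X to M and G *)

Lemma monoid_finite_level (S : solution) :
  finite_multipermutation_level S ->
  finite_multipermutation_level (monoid_solution S).
Proof.
move=> /finite_levelP [m hm].
have stL := monoid_rel_stable (solution_braided S).
have stR := monoid_rel_stableC (solution_braided S).
apply: (word_finite_level S (lam S) (rho S) (monoid_solution S) _
  (pres_lamE stL stR) (pres_rhoE stL stR) _ (fun n => iter n Ret S)
  (fun n => lam (iter n Ret S)) (fun n => rho (iter n Ret S)) (proj S)
  (fun n => (proj_morphism S n).1) (fun n => (proj_morphism S n).2)
  _ _ _ m) => //.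
- by elim/pres_ind=> u; exists u.
- by move=> n a a' b /projSP h; have [] := h b.
- by move=> n a a' b /projSP h; have [] := h b.
Qed.

Lemma group_finite_level (S : solution) :
  finite_multipermutation_level S ->
  finite_multipermutation_level (group_solution S).
Proof.
move=> /finite_levelP [m hm].
have stL := group_rel_stable (solution_birack S).
have stR := group_rel_stableC (solution_birack S).
have fL n := letter_map_lam _ _ _ (proj_morphism S n).
have fP n := letter_map_rho _ _ _ (proj_morphism S n).
apply: (word_finite_level (letter S) (sol_letter_lam S) (sol_letter_rho S)
  (group_solution S) _ (pres_lamE stL stR) (pres_rhoE stL stR) _
  (fun n => letter (iter n Ret S)) (fun n => sol_letter_lam (iter n Ret S))
  (fun n => sol_letter_rho (iter n Ret S)) (fun n => letter_map (proj S n))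
  fL fP _ _ _ m).
- by elim/pres_ind=> u; exists u.
- by case=> x [] y // [->].
- by move=> n a a' b /letter_retr_proj h; rewrite !fL; apply: letter_retr_lam.
- by move=> n a a' b /letter_retr_proj h; rewrite !fP; apply: letter_retr_rho.
- by case=> x [] y /=; congr (_ _); apply: hm.
- by case=> x [] y /=; congr (_ _); apply: hm.
Qed.

(** * From M and G back to X *)

(** Congruent words act on a single letter [z] with literally equal results, so lambda_x(z) and
    rho_x(z) can be read off the class of the word [[:: x]]. *)
Lemma monoid_gen_retr (S : solution) (x y : S) :
  monoid_gen x = monoid_gen y -> retr x y.
Proof.
move=> /wordP xy; split; apply: funext => z.
  have stR := monoid_rel_stableC (solution_braided S).
  by have [] := stable_congr stR xy z.
have stL := monoid_rel_stable (solution_braided S).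
by have [] := stable_cong stL xy z.
Qed.

Lemma group_gen_retr (S : solution) (x y : S) :
  group_gen x = group_gen y -> retr x y.
Proof.
move=> /wordP xy; split; apply: funext => z.
  have stR := group_rel_stableC (solution_birack S).
  by have [_ []] := stable_congr stR xy (Gen z).
have stL := group_rel_stable (solution_birack S).
by have [_ []] := stable_cong stL xy (Gen z).
Qed.

Lemma monoid_gen_morphism (S : solution) :
  morphism S (monoid_solution S) (@monoid_gen S).
Proof.
split=> x y.
  exact: esym (congr1 fst (monoid_braiding_gen x y)).
exact: esym (congr1 snd (monoid_braiding_gen x y)).
Qed.

Lemma group_gen_morphism (S : solution) :
  morphism S (group_solution S) (@group_gen S).
Proof.
split=> x y.
  exact: esym (congr1 fst (group_braiding_gen x y)).
exact: esym (congr1 snd (group_braiding_gen x y)).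
Qed.

Theorem theorem4p13 (S : solution) :
  (finite_multipermutation_level S <->
   finite_multipermutation_level (monoid_solution S)) /\
  (finite_multipermutation_level S <->
   finite_multipermutation_level (group_solution S)).
Proof.
split; split.
- exact: monoid_finite_level.
- apply: finite_level_preimage (monoid_gen_morphism S) _.
  exact: monoid_gen_retr.
- exact: group_finite_level.
- apply: finite_level_preimage (group_gen_morphism S) _.
  exact: group_gen_retr.
Qed.
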